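(* Let $[\widehat{0},\widehat{1}]$ be a graded dual simplicial Eulerian poset of rank $n+1$. If the toric $h$-vector $(h_0,\ldots,h_n)$ of $(\widehat{0},\widehat{1}]^*$ satisfies $h_0\leq h_1\leq\cdots\leq h_{\lfloor n/2\rfloor}$, then $f([\widehat{0},\widehat{1}],x)$ has nonnegative coefficients.
   Context: A graded poset is a finite poset with a unique minimum $\widehat{0}$, a unique maximum $\widehat{1}$ and a rank function $\rho:P\to\mathbb{N}$ with $\rho(\widehat{0})=0$ and $\rho(y)=\rho(x)+1$ whenever $y$ covers $x$; its rank is $\rho(\widehat{1})$. It is Eulerian if $\sum_{z\in[u,v]}(-1)^{\rho(z)}=0$ for all $u<v$. It is dual simplicial if for every $t\neq\widehat{0}$ the interval $[t,\widehat{1}]$ is a Boolean algebra. $Q^*$ denotes the dual (order-reversed) poset of $Q$. Write $[\widehat{0},p)=\{q: q<p\}$ and $(\widehat{0},\widehat{1}]=[\widehat{0},\widehat{1}]\setminus\{\widehat{0}\}$. Stanley's toric polynomials: $f(\emptyset,x)=g(\emptyset,x)=1$ ($\emptyset$ being $[\widehat{0},\widehat{1})$ for the Eulerian poset of rank $0$), and for an Eulerian poset of rank at least $1$, $$f([\widehat{0},\widehat{1}),x)=\sum_{p\in[\widehat{0},\widehat{1})} g([\widehat{0},p),x)(x-1)^{\rho(\widehat{1})-1-\rho(p)},$$ $$g([\widehat{0},\widehat{1}),x)=\sum_{i=0}^{\lfloor(\rho(\widehat{1})-1)/2\rfloor}\left([x^i]f([\widehat{0},\widehat{1}),x)-[x^{i-1}]f([\widehat{0},\widehat{1}),x)\right)x^i.$$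 Closed interval version: a finite poset $P$ with unique minimum $\widehat{0}$ is lower Eulerian if every $[\widehat{0},p]$ is Eulerian, and then $f(P,x)=\sum_{p\in P}g([\widehat{0},p),x)(x-1)^{m-\rho(p)}$, where $m$ is the length of the longest chain in $P$. The polynomial $f([\widehat{0},\widehat{1}],x)$ is this polynomial for the lower Eulerian poset $P=[\widehat{0},\widehat{1}]$ (including its maximum element), for which $m=n+1$. Toric $h$-vector: for an Eulerian poset $Q$ of rank $n+1$, the toric $h$-vector $(h_0,\dots,h_n)$ of $Q\setminus\{\widehat{1}_Q\}$ is defined by $\sum_i h_ix^i=x^nf(Q\setminus\{\widehat{1}_Q\},1/x)$ (which, by a theorem of Stanley, equals $f(Q\setminus\{\widehat{1}_Q\},x)$). Here it is applied to $Q=[\widehat{0},\widehat{1}]^*$, whose maximum is $\widehat{0}$. *)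

(* Defs.v *)
From HB Require Import structures.
From mathcomp Require Import all_boot all_order all_algebra.
From mathcomp Require Import zify.
Set Implicit Arguments.
Unset Strict Implicit.
Unset Printing Implicit Defensive.
Import Order.Theory GRing.Theory Num.Theory.
Local Open Scope ring_scope.
Local Open Scope order_scope.

(* A graded poset is a pair (P, rho) with P : finTBPOrderType and rho a rank
   function on P.  In any graded poset the interval [\bot, p] is graded by the
   restriction of rho, so its toric polynomials are functions of p. *)

Section Posets.
Variables (d : Order.disp_t).

Definition covers (P : finPOrderType d) (y x : P) : Prop :=
  x < y /\ forall z : P, ~~ (x < z < y).

Definition rank_function (P : finBPOrderType d) (rho : P -> nat) : Prop :=
  rho \bot = 0%N /\ forall x y : P, covers y x -> rho y = (rho x).+1.

Definition eulerian (P : finPOrderType d) (rho : P -> nat) : Prop :=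
  forall u v : P, u < v -> (\sum_(z | (u <= z <= v)%O) (-1) ^+ rho z)%R = 0%R :> int.

(* The interval [t, \top] is isomorphic to the poset of all subsets of a
   finite set; the values of f outside the interval are irrelevant. *)
Definition boolean_upper_interval (P : finPOrderType d) (t : P) : Prop :=
  exists (k : nat) (f : P -> {set 'I_k}),
    (forall x y, t <= x -> t <= y -> (x <= y) = (f x \subset f y)) /\
    (forall A : {set 'I_k}, exists2 x, t <= x & f x = A).

Definition dual_simplicial (P : finBPOrderType d) : Prop :=
  forall t : P, t != \bot -> boolean_upper_interval t.

Definition is_chain (P : finPOrderType d) (C : {set P}) : bool :=
  [forall x in C, forall y in C, (x <= y) || (y <= x)].

Definition longest_chain (P : finPOrderType d) : nat :=
  (\max_(C : {set P} | is_chain C) #|C|.-1)%N.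

Lemma rank_lt (P : finBPOrderType d) (rho : P -> nat) (x y : P) :
  rank_function rho -> x < y -> (rho x < rho y)%N.
Proof.
move=> [_ hrho]; have [k] := ubnP #|[set z : P | x < z < y]|.
elim: k x y => // k IH x y hk ltxy.
have [/existsP [z hz]|/existsPn nz] := boolP [exists z, x < z < y]; last first.
  by rewrite (hrho x y).
have /andP[xz zy] := hz.
have sub (a b : P) : x <= a -> b <= y -> (z == a) || (z == b) ->
    (#|[set w | (a < w < b)%O]| < k)%N.
  move=> xa yb zab; rewrite ltnS in hk; apply: leq_trans hk; apply: proper_card.
  apply/properP; split.
    apply/subsetP=> w; rewrite !inE => /andP[aw wb].
    by rewrite (le_lt_trans xa aw) (lt_le_trans wb yb).
  exists z; rewrite !inE ?hz //.
  by case/orP: zab => /eqP <-; rewrite ltxx ?andbF.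
apply: (@ltn_trans (rho z)); apply: IH => //; apply: sub => //.
- exact: ltW.
- by rewrite eqxx orbT.
- exact: ltW.
- by rewrite eqxx.
Qed.

Definition dual_rank (P : finTBPOrderType d) (rho : P -> nat) : P^d -> nat :=
  fun t => (rho \top - rho (t : P))%N.

End Posets.

Lemma dual_rankP (d : Order.disp_t) (P : finTBPOrderType d) (rho : P -> nat) :
  rank_function rho -> rank_function (dual_rank rho).
Proof.
move=> hrho; split; first by rewrite /dual_rank botEdual subnn.
move=> x y [ltyx nz]; rewrite /dual_rank; move: ltyx nz; rewrite ltEdual => ltyx nz.
have e : rho (x : P) = (rho (y : P)).+1.
  case: hrho => _; apply; split=> // z; move: (nz z).
  by rewrite !ltEdual andbC.
have : (rho (x : P) <= rho \top)%N.
  have := lex1 (x : P); rewrite le_eqVlt => /orP[/eqP ->//|h].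
  exact/ltnW/(rank_lt hrho).
move: e; lia.
Qed.

Lemma longest_chain_rank (d : Order.disp_t) (P : finTBPOrderType d)
    (rho : P -> nat) :
  rank_function rho -> longest_chain P = rho \top.
Proof.
move=> hrho; apply/eqP; rewrite eqn_leq; apply/andP; split.
  apply/bigmax_leqP => C hC.
  have bnd (x : P) : (rho x < (rho \top%O).+1)%N.
    have := lex1 x; rewrite le_eqVlt ltnS => /orP[/eqP ->//|h].
    exact/ltnW/(rank_lt hrho).
  have inj : {in C &, injective (fun x => Ordinal (bnd x))}.
    move=> x y xC yC [] e; move: hC => /forall_inP/(_ _ xC)/forall_inP/(_ _ yC).
    case/orP; rewrite le_eqVlt => /orP[/eqP//|/(rank_lt hrho)].
      by rewrite e ltnn.
    by rewrite e ltnn.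
  rewrite -(card_in_imset inj).
  have h : (#|[set Ordinal (bnd x) | x in C]| <= (rho \top%O).+1)%N.
    by rewrite -[X in (_ <= X)%N]card_ord max_card.
  by move: h; case: #|_|.
have chain k (p : P) : rho p = k -> exists C : {set P},
    [/\ is_chain C, forall x, x \in C -> x <= p & #|C| = k.+1].
  elim: k p => [|k IH] p hp.
    exists [set p]; split; last exact: cards1.
      apply/forall_inP => x /set1P ->; apply/forall_inP => y /set1P ->.
      by rewrite lexx.
    by move=> x /set1P ->.
  have pb : \bot < p by rewrite lt0x; apply/eqP => e; move: hp; rewrite e hrho.1.
  have [q qp hq] := @arg_maxnP _ \bot (fun q : P => q < p) rho pb.
  have cov : covers p q.
    split=> // z; apply/negP => /andP[qz zp].
    have h : (rho z <= rho q)%N := hq z zp.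
    by have := rank_lt hrho qz; rewrite ltnNge h.
  have [C [cC Cq sC]] := IH q ltac:(by move: (hrho.2 _ _ cov); rewrite hp => -[]).
  have Cp x : x \in C -> x < p by move=> /Cq /le_lt_trans; apply.
  exists (p |: C); split.
  - apply/forall_inP => x /setU1P hx; apply/forall_inP => y /setU1P hy.
    case: hx hy => [->|xC] [->|yC]; rewrite ?lexx //.
    + by rewrite (ltW (Cp _ yC)) orbT.
    + by rewrite (ltW (Cp _ xC)).
    + by move: cC => /forall_inP/(_ _ xC)/forall_inP/(_ _ yC).
  - by move=> x /setU1P [->|/Cp/ltW].
  - rewrite cardsU1 sC; suff -> : p \notin C by [].
    by apply/negP => /Cp; rewrite ltxx.
have [C [cC _ sC]] := chain _ \top erefl.
have := @leq_bigmax_cond _ _ (fun C : {set P} => #|C|.-1) C cC.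
by rewrite sC.
Qed.

Section Toric.
Variables (d : Order.disp_t) (P : finBPOrderType d) (rho : P -> nat).

(* sum_(0 <= i <= m) ([x^i] f - [x^(i-1)] f) x^i, with [x^(-1)] f = 0 *)
Definition toric_trunc (m : nat) (f : {poly int}) : {poly int} :=
  (\poly_(i < m.+1) (f`_i - (if i is j.+1 then f`_j else 0)))%R.

(* k is recursion fuel; any k exceeding the number of elements below p gives
   the same result, see toric_gE. *)
Fixpoint toric_g_rec (k : nat) (p : P) : {poly int} :=
  (if k is k'.+1 then
     if p == \bot%O then 1
     else toric_trunc (rho p).-1./2
       (\sum_(q | (q < p)%O) toric_g_rec k' q * ('X - 1) ^+ (rho p - 1 - rho q))
   else 1)%R.

(* g([\bot, p), x) *)
Definition toric_g (p : P) : {poly int} := toric_g_rec #|P| p.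

(* f([\bot, p), x) *)
Definition toric_f (p : P) : {poly int} :=
  (if p == \bot%O then 1
   else \sum_(q | (q < p)%O) toric_g q * ('X - 1) ^+ (rho p - 1 - rho q))%R.

(* f(P, x) for the whole of P, including its maximum if there is one *)
Definition toric_f_lower : {poly int} :=
  (\sum_(p : P) toric_g p * ('X - 1) ^+ (longest_chain P - rho p))%R.

Lemma toric_gE (p : P) :
  toric_g p = if p == \bot then 1%R else toric_trunc (rho p).-1./2 (toric_f p).
Proof.
have below_lt (q r : P) : q < r ->
    (#|[set w : P | (w < q)%O]| < #|[set w : P | (w < r)%O]|)%N.
  move=> qr; apply: proper_card; apply/properP; split.
    by apply/subsetP=> w; rewrite !inE => /lt_trans; apply.
  by exists q; rewrite !inE ?ltxx.
have below_card (q : P) : (#|[set w : P | (w < q)%O]| < #|P|)%N.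
  rewrite -cardsT; apply: proper_card; apply/properP; split.
    by apply/subsetP=> w; rewrite !inE.
  by exists q; rewrite !inE ?ltxx.
have fuel k l (q : P) : (#|[set w : P | (w < q)%O]| < k)%N ->
    (#|[set w : P | (w < q)%O]| < l)%N -> toric_g_rec k q = toric_g_rec l q.
  elim: k l q => // k IH [//|l] q hk hl /=.
  case: ifP => // _; congr toric_trunc; apply: eq_bigr => r rq.
  by rewrite (IH l r) //; apply: leq_trans (below_lt _ _ rq) _.
rewrite /toric_f /toric_g (fuel _ #|P|.+1 p (below_card p) (ltnW (below_card p))).
rewrite /=; case: ifP => // _.
Qed.

Lemma size_toric_f (p : P) :
  rank_function rho -> p != \bot -> (size (toric_f p) <= rho p)%N.
Proof.
move=> hrho np; rewrite /toric_f (negPf np).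
apply: (leq_trans (size_sum _ _ _)); apply/bigmax_leqP => q qp.
have lt_qp := rank_lt hrho qp.
apply: (leq_trans (size_polyMleq _ _)).
rewrite (_ : 'X - 1 = 'X - 1%:P)%R // size_exp_XsubC.
have : (size (toric_g q) <= (rho q).+1)%N.
  rewrite toric_gE; case: ifP => _; first by rewrite size_poly1.
  apply: (leq_trans (size_poly _ _)); lia.
lia.
Qed.

End Toric.

(* sum_i h_i x^i = x^n f(Q \ {\top}, 1/x), where n + 1 is the rank of Q; as a
   polynomial this is f with its n + 1 coefficients reversed, see toric_hE. *)
Definition toric_h (d : Order.disp_t) (Q : finTBPOrderType d)
    (rho : Q -> nat) : {poly int} :=
  let n := (rho \top%O).-1 in
  (\poly_(i < n.+1) (toric_f rho \top%O)`_(n - i))%R.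

Lemma toric_hE (d : Order.disp_t) (Q : finTBPOrderType d) (rho : Q -> nat)
    (n : nat) (x : rat) :
  rank_function rho -> rho \top = n.+1 -> x != 0%R ->
  ((map_poly intr (toric_h rho)).[x]
    = x ^+ n * (map_poly intr (toric_f rho \top%O)).[x^-1])%R.
Proof.
move=> hrho hn nx.
have np : (\top : Q) != \bot.
  by apply/eqP => e; move: hn; rewrite e hrho.1.
have sf := size_toric_f hrho np; rewrite hn in sf.
rewrite (horner_coef_wide _ (leq_trans (size_poly _ _) sf)).
have sh : (size (toric_h rho) <= n.+1)%N by rewrite /toric_h hn /= size_poly.
rewrite (horner_coef_wide _ (leq_trans (size_poly _ _) sh)).
rewrite mulr_sumr (reindex_inj rev_ord_inj) /=; apply: eq_bigr => i _.
have hi := ltn_ord i.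
rewrite !coef_map_id0 // /toric_h hn /= coef_poly subSS ltnS leq_subr subKn //.
rewrite mulrCA; congr (_ * _)%R.
by rewrite exprVn expfB_cond // (negPf nx) //.
Qed.

(* Main.v *)
(* Write N = n + 1 and let h_s(x) be the h-polynomial of the simplicial poset
   dual to (\bot, s], with g_s the truncation of (1 - x) h_s at degree
   (rho s - 1) / 2.  The polynomials
   K_p = \sum_(\bot < s <= p) (-1)^(rho s - 1) g_s, with K_\bot = 1,
   satisfy \sum_(q <= p) K_q (x - 1)^(rho p - rho q) = x^(rho p) K_p(1/x): this
   follows from the Dehn-Sommerville equations x^(rho s - 1) h_s(1/x) = h_s and
   from the binomial theorem in the Boolean intervals [s, p].  Together with the
   degree bound on K_p this identity characterizes the toric g-polynomial, so
   toric_g p = K_p, and f(P, x) is K_\top with its coefficients reversed.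

   To expand K_\top in terms of g_\top, homogenize (1 - x) h_\top = \sum_i
   g_i (x^i - x^(N-i)) at (y + w, 1 + w): this yields the generating function
   \sum_s w^(N - rho s) (1 - y) h_s(y), and an alternating sum of its
   coefficients gives
     [x^k] K_\top = \sum_i g_i (C(i,k) C(N-i-1,k) - C(N-i,k) C(i-1,k)),
   for 2k < N (the subtracted product being 0 when i = 0).  The brackets are
   nonnegative for i <= n/2, and g_i = h_i - h_(i-1) is nonnegative by
   hypothesis. *)
From HB Require Import structures.
Require Import Defs.
From mathcomp Require Import all_boot all_order all_algebra.
From mathcomp Require Import zify ring.
Set Implicit Arguments.
Unset Strict Implicit.
Import Order.Theory GRing.Theory Num.Theory.
Local Open Scope ring_scope.

(** * Binomial theorem in Boolean intervals *)

Lemma sum_subsets_exp (R : comNzRingType) (T : finType) (B : {set T}) (a b : R) :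
  \sum_(A : {set T} | A \subset B) a ^+ #|A| * b ^+ (#|B| - #|A|)
    = (a + b) ^+ #|B|.
Proof.
rewrite addrC exprDn (partition_big (fun A : {set T} => inord #|A| : 'I_#|B|.+1) xpredT) //=.
apply: eq_bigr => i _.
rewrite (eq_bigl (fun A : {set T} => A \in [set A : {set T} | A \subset B & #|A| == i])).
  rewrite (eq_bigr (fun=> b ^+ (#|B| - i) * a ^+ i)); first by rewrite sumr_const cards_draws.
  by move=> A; rewrite inE => /andP[_ /eqP ->]; rewrite mulrC.
move=> A; rewrite inE; case sAB: (A \subset B) => //=.
rewrite -(inj_eq val_inj) /= inordK // ltnS.
exact: subset_leq_card.
Qed.

(** The bijection [f] turns the sum into one over the subsets of [f p], once
    [rho s = rho t + #|f s|] is known. *)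
Lemma boolean_interval_sum (d : Order.disp_t) (P : finBPOrderType d)
    (rho : P -> nat) (R : comNzRingType) (a b : R) (t p : P) :
  rank_function rho -> boolean_upper_interval t -> (t <= p)%O ->
  \sum_(s | (t <= s <= p)%O) a ^+ (rho s - rho t) * b ^+ (rho p - rho s)
    = (a + b) ^+ (rho p - rho t).
Proof.
move=> [_ hcov] [k [f [fle /fin_all_exists2 [g tg fg]]]] tp.
have gf s : (t <= s)%O -> g (f s) = s.
  by move=> ts; apply: le_anti; rewrite (fle _ _ (tg _) ts) (fle _ _ ts (tg _)) fg subxx.
have ft : f t = set0.
  by apply/eqP; rewrite -subset0 -(fg set0) -(fle _ _ (lexx t) (tg _)) tg.
(* Deleting a point from [f s] gives an element covered by [s], so [rho] drops by one with the
   cardinality. *)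
have rank m s : (t <= s)%O -> #|f s| = m -> rho s = (rho t + m)%N.
  elim: m s => [|m IH] s ts fs.
    by rewrite -(gf s ts) (cards0_eq fs) -ft gf // addn0.
  have [x xs] : exists x, x \in f s by apply/card_gt0P; rewrite fs.
  have cA : #|f s :\ x| = m by move: fs; rewrite (cardsD1 x) xs => -[].
  have gs : (g (f s :\ x) <= s)%O by rewrite (fle _ _ (tg _) ts) fg subD1set.
  rewrite addnS -(IH _ (tg (f s :\ x))) ?fg //; apply: hcov; split.
    rewrite lt_neqAle gs andbT; apply/eqP => e.
    by move: xs; rewrite -e fg !inE eqxx.
  move=> z; apply/negP => /andP[gz zs].
  have tz : (t <= z)%O := le_trans (tg _) (ltW gz).
  have := gz; rewrite lt_leAnge (fle _ _ (tg _) tz) (fle _ _ tz (tg _)) fg => /andP[s1 s2].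
  have := zs; rewrite lt_leAnge (fle _ _ tz ts) (fle _ _ ts tz) => /andP[s3 s4].
  have := proper_card (introT andP (conj s1 s2)).
  have := proper_card (introT andP (conj s3 s4)).
  by rewrite fs cA; lia.
have rankE s : (t <= s)%O -> rho s = (rho t + #|f s|)%N by move=> ts; apply: rank.
rewrite (reindex_onto g f) /=; last by move=> s /andP[/gf].
rewrite [in RHS]rankE // addKn -sum_subsets_exp; apply: eq_big => [A|A _].
  by rewrite fg eqxx andbT tg /= (fle _ _ (tg _) tp) fg.
by rewrite !(rankE (g A)) // (rankE p) // fg addKn subnDl.
Qed.

(** * Homogenization, coefficient reversal and truncation *)

(* The binary form of degree [N] that restricts to [p] at [b = 1]; at [(1, 'X)]
   it reverses the coefficients of [p] (see revpE). *)
Definition homog (R : comNzRingType) (N : nat) (a b : R) (p : {poly int}) : R :=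
  \sum_(i < N.+1) (a ^+ i * b ^+ (N - i)) *~ p`_i.

Section Homog.
Variables (R : comNzRingType) (a b : R).
Implicit Types (N : nat) (p q : {poly int}).

Lemma homog_is_additive N : zmod_morphism (homog N a b).
Proof.
move=> p q; rewrite /homog -sumrB; apply: eq_bigr => i _.
by rewrite coefB mulrzBr.
Qed.

HB.instance Definition _ N := GRing.isZmodMorphism.Build {poly int} R
  (homog N a b) (homog_is_additive N).

Lemma homog_mulX N p : homog N.+1 a b (p * 'X) = a * homog N a b p.
Proof.
rewrite /homog big_ord_recl coefMX mulr0z add0r mulr_sumr.
by apply: eq_bigr => i _; rewrite coefMX /= mulrzAr exprS mulrA subSS.
Qed.

Lemma homog_widen m N p : (size p <= m.+1)%N -> (m <= N)%N ->
  homog N a b p = b ^+ (N - m) * homog m a b p.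
Proof.
move=> sp mN; rewrite /homog mulr_sumr.
rewrite (big_ord_widen_cond N.+1 xpredT
  (fun i => b ^+ (N - m) * ((a ^+ i * b ^+ (m - i)) *~ p`_i))) //=.
rewrite [RHS]big_mkcond /=; apply: eq_bigr => i _; case: ifP => im.
  rewrite mulrzAr mulrCA -exprD; congr (_ * _ ^+ _ *~ _); lia.
by rewrite nth_default ?mulr0z // (leq_trans sp) // leqNgt im.
Qed.

Lemma homog_XsubC N j : (j <= N)%N ->
  homog N a b (('X - 1) ^+ j) = (a - b) ^+ j * b ^+ (N - j).
Proof.
have diag k : homog k a b (('X - 1) ^+ k) = (a - b) ^+ k.
  elim: k => [|k IH]; first by rewrite /homog big_ord1 !expr0 coefC /= mul1r.
  rewrite exprSr mulrBr mulr1 raddfB /= homog_mulX (@homog_widen k k.+1) ?leqnSn //.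
    by rewrite subSnn expr1 IH -mulrBl exprS.
  by rewrite (size_exp_XsubC _ (1 : int)).
move=> jN; rewrite (@homog_widen j) ?diag 1?mulrC //.
by rewrite (size_exp_XsubC _ (1 : int)).
Qed.

End Homog.

Definition revp (N : nat) (p : {poly int}) : {poly int} :=
  \poly_(i < N.+1) p`_(N - i).

Lemma revpE (N : nat) (p : {poly int}) : revp N p = homog N 1 'X p.
Proof.
rewrite /revp poly_def /homog (reindex_inj rev_ord_inj) /=.
apply: eq_bigr => i _; rewrite subSS expr1n mul1r -mul_polyC.
by rewrite subKn -1?ltnS // -[in LHS](intz p`_i) rmorph_int mulrzl.
Qed.

Lemma homog_revp (R : comNzRingType) (a b : R) (N : nat) (p : {poly int}) :
  homog N a b (revp N p) = homog N b a p.
Proof.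
rewrite /homog (reindex_inj rev_ord_inj) /=; apply: eq_bigr => i _.
by rewrite coef_poly subSS ltnS leq_subr subKn 1?mulrC // -ltnS.
Qed.

Lemma toric_truncE (m : nat) (f : {poly int}) :
  toric_trunc m f = take_poly m.+1 ((1 - 'X) * f).
Proof.
apply/polyP => i; rewrite coef_take_poly coef_poly mulrBl mul1r coefB coefXM.
by case: i.
Qed.

(** * A binomial inequality and alternating coefficient sums *)

(** For m >= k the ratio C(m+1,k) / C(m,k) = (m+1) / (m+1-k) decreases in m; the factor (a+1)(b+1)
    clears denominators. *)
Lemma bin_mul_le (a b k : nat) : (a <= b)%N ->
  ('C(b.+1, k) * 'C(a, k) <= 'C(a.+1, k) * 'C(b, k))%N.
Proof.
move=> ab; case: (ltnP a k) => [/bin_small ->|ka]; first by rewrite muln0.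
have ea := mul_bin_down a.+1 k; have eb := mul_bin_down b.+1 k.
rewrite /= in ea eb.
rewrite -(@leq_pmul2l (a.+1 * b.+1)) ?muln_gt0 //.
have -> : (a.+1 * b.+1 * ('C(b.+1, k) * 'C(a, k)) =
  b.+1 * (a.+1 - k) * ('C(b.+1, k) * 'C(a.+1, k)))%N.
  by transitivity (b.+1 * 'C(b.+1, k) * (a.+1 * 'C(a, k)))%N; [ring | rewrite ea; ring].
have -> : (a.+1 * b.+1 * ('C(a.+1, k) * 'C(b, k)) =
  a.+1 * (b.+1 - k) * ('C(b.+1, k) * 'C(a.+1, k)))%N.
  by transitivity (a.+1 * 'C(a.+1, k) * (b.+1 * 'C(b, k)))%N; [ring | rewrite eb; ring].
by apply: leq_mul => //; nia.
Qed.

(** Evaluation at -1 truncated after degree [M]; up to the sign (-1)^M, the coefficient of X^M in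
    the power series p / (1 + X). *)
Definition altsum (M : nat) (p : {poly int}) : int :=
  \sum_(e < M.+1) (-1) ^+ e * p`_e.

Lemma altsum_is_additive (M : nat) : zmod_morphism (altsum M).
Proof.
by move=> p q; rewrite /altsum -sumrB; apply: eq_bigr => e _; rewrite coefB mulrBr.
Qed.

HB.instance Definition _ M := GRing.isZmodMorphism.Build {poly int} int
  (altsum M) (altsum_is_additive M).

Lemma altsum_Xn (M m : nat) (c : int) :
  altsum M ('X^m * c%:P) = if (m <= M)%N then (-1) ^+ m * c else 0.
Proof.
rewrite /altsum; case: leqP => mM.
  rewrite (bigD1 (Ordinal (mM : (m < M.+1)%N))) //= coefMC coefXn eqxx mul1r.
  rewrite big1 ?addr0 // => e; rewrite -(inj_eq val_inj) /= => /negPf ne.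
  by rewrite coefMC coefXn ne mul0r mulr0.
apply: big1 => e _; rewrite coefMC coefXn ltn_eqF ?mul0r ?mulr0 //.
exact: leq_ltn_trans (leq_ord e) mM.
Qed.

Lemma altsum_mul1X (M : nat) (p : {poly int}) :
  altsum M (p * (1 + 'X)) = (-1) ^+ M * p`_M.
Proof.
rewrite /altsum mulrDr mulr1; elim: M => [|M IH].
  by rewrite big_ord1 coefD coefMX addr0.
by rewrite big_ord_recr IH /= coefD coefMX /= mulrDr addrCA exprS mulN1r !mulNr subrr addr0.
Qed.

Lemma coef_XaddC_exp (R : comNzRingType) (c : R) (m k : nat) :
  (('X + c%:P) ^+ m)`_k = c ^+ (m - k) *+ 'C(m, k).
Proof.
have -> : ('X + c%:P) ^+ m = \poly_(i < m.+1) (c ^+ (m - i) *+ 'C(m, i)).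
  rewrite addrC exprDn poly_def; apply: eq_bigr => i _.
  by rewrite -mul_polyC polyCMn -mulrnAl -rmorphXn.
rewrite coef_poly; case: ltnP => // mk.
by rewrite bin_small.
Qed.

(** The alternating sum cancels one factor 1 + X. For k <= b this leaves the coefficient of X^(a-k)
    in (1 + X)^a. *)
Lemma altsum_bin (a b k : nat) : (k.*2 < a.+1 + b)%N ->
  altsum (a.+1 + b - k.*2.+1)%N (('X^(b - k) *+ 'C(b, k)) * (1 + 'X) ^+ a.+1)
   = (-1) ^+ (a.+1 + b - k.*2.+1)%N * ('C(b, k) * 'C(a, k))%:R.
Proof.
move=> kab; case: (ltnP b k) => [/bin_small ->|kb].
  by rewrite mulr0n mul0r mul0n mulr0 raddf0.
rewrite exprSr mulrA altsum_mul1X mulrnAl coefMn natrM -[_`__ *+ _]mulr_natl.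
suff -> : ('X^(b - k) * (1 + 'X) ^+ a : {poly int})`_(a.+1 + b - k.*2.+1)
    = ('C(a, k))%:R by [].
rewrite coefXnM; case: ltnP => h; first by rewrite bin_small //; lia.
rewrite addrC -polyC1 coef_XaddC_exp expr1n; congr (_%:R).
case: (leqP k a) => ka; last by rewrite !bin_small //; lia.
by rewrite -[RHS]bin_sub //; congr 'C(_, _); lia.
Qed.

(** * Differences of a palindromic polynomial *)

(** Since [h] is palindromic, (1 - X) h is antisymmetric in degree n + 1, and [g] is its lower
    half. *)
Lemma revp_antisym (n : nat) (h : {poly int}) : revp n h = h ->
  let g := take_poly n./2.+1 ((1 - 'X) * h) in
  revp n.+1 g = g + ('X - 1) * h.
Proof.
move=> sym g; pose c i := h`_i - (if i is j.+1 then h`_j else 0).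
have coefc i : ((1 - 'X) * h)`_i = c i.
  by rewrite mulrBl mul1r coefB coefXM /c; case: i.
have hsym i : h`_i = if (i < n.+1)%N then h`_(n - i) else 0.
  by rewrite -[in LHS]sym coef_poly.
have c0 i : (n.+1 < i)%N -> c i = 0.
  case: i => // i ni; rewrite /c [h`_i]hsym [h`_i.+1]hsym !ifN ?subr0 //; lia.
have anti i : (i <= n.+1)%N -> c (n.+1 - i)%N = - c i.
  case: i => [_|i]; rewrite /c.
    by rewrite subn0 hsym ltnn sub0r subr0 hsym ltnS leqnn subnn.
  rewrite ltnS subSS => ni; rewrite opprB [h`_i]hsym ltnS ni; congr (_ - _).
  case e: (n - i)%N => [|j]; rewrite [RHS]hsym; first by rewrite ltnNge ltnS -subn_eq0 e.
  rewrite ltnS (_ : (i < n)%N = true); last by rewrite -subn_gt0 e.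
  by congr (h`_ _); lia.
apply/polyP => i; rewrite coef_poly coefD -[('X - 1)]opprB mulNr coefN.
rewrite /g !coef_take_poly !coefc ltnS.
case: (leqP i n.+1) => [ni|/c0 ->]; last by rewrite if_same subr0.
rewrite anti //; case: ifP => h1; case: ifP => h2; rewrite ?subrr ?sub0r //.
  by move: h1 h2; rewrite -[n in (n.+1 - _)%N]odd_double_half; lia.
(* Only the middle degree remains; its coefficient is its own negative, hence zero. *)
have e : (n.+1 - i = i)%N by move: h1 h2; have := odd_double_half n; lia.
by have := anti i ni; rewrite e; lia.
Qed.

(** * The polynomials h, g and K of lower intervals *)

Section DualSimplicial.
Variables (d : Order.disp_t) (P : finTBPOrderType d) (rho : P -> nat).
Hypotheses (hgraded : rank_function rho) (heulerian : eulerian rho).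
Hypothesis hdual : dual_simplicial P.

(* The [h]-polynomial of the simplicial poset dual to [(\bot, s]]. *)
Definition hpoly (s : P) : {poly int} :=
  \sum_(t | (\bot < t <= s)%O) ('X - 1) ^+ (rho t).-1.

Definition gpoly (s : P) : {poly int} :=
  take_poly ((rho s).-1)./2.+1 ((1 - 'X) * hpoly s).

(** The K_p of the overview: a Kazhdan-Lusztig-Stanley polynomial for the kernel (x - 1)^(rho p -
    rho q), by [klpoly_revp] and [size_klpoly]. *)
Definition klpoly (p : P) : {poly int} :=
  if p == \bot%O then 1
  else \sum_(s | (\bot < s <= p)%O) (-1) ^+ (rho s).-1 * gpoly s.

Lemma rank_le (x y : P) : (x <= y)%O -> (rho x <= rho y)%N.
Proof. by rewrite le_eqVlt => /orP[/eqP ->//|/(rank_lt hgraded)/ltnW]. Qed.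

Lemma rank_gt0 (x : P) : (\bot < x)%O -> (0 < rho x)%N.
Proof. by move=> /(rank_lt hgraded); rewrite hgraded.1. Qed.

Lemma interval_sum (R : comNzRingType) (a b : R) (t p : P) :
  (\bot < t)%O -> (t <= p)%O ->
  \sum_(s | (t <= s <= p)%O) a ^+ (rho s - rho t) * b ^+ (rho p - rho s)
    = (a + b) ^+ (rho p - rho t).
Proof. by rewrite lt0x => /hdual ht tp; exact: boolean_interval_sum. Qed.

(** The Eulerian relation on [\bot, s], with the term of [\bot] moved across. *)
Lemma sum_sign_below (R : pzRingType) (s : P) : (\bot < s)%O ->
  \sum_(t | (\bot < t <= s)%O) (-1) ^+ (rho t).-1 = 1 :> R.
Proof.
move=> s0; have := heulerian s0; rewrite (bigD1 \bot%O) ?lexx ?(ltW s0) //=.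
rewrite hgraded.1 expr0 => /eqP; rewrite addrC addr_eq0 => /eqP e.
transitivity ((\sum_(t | (\bot < t <= s)%O) (-1) ^+ (rho t).-1 : int)%:~R : R).
  by rewrite rmorph_sum; apply: eq_bigr => t _; rewrite rmorph_sign.
rewrite -[RHS](rmorph1 (intr : int -> R)); apply: (congr1 (fun z : int => z%:~R : R)); apply: oppr_inj.
rewrite -[RHS]e -sumrN; apply: eq_big => [t|t /andP[/rank_gt0 t0 _]].
  by rewrite le0x /= lt0x andbC.
by rewrite -[in RHS](prednK t0) exprS mulN1r.
Qed.

Lemma mul_hpoly (s : P) :
  ('X - 1) * hpoly s = \sum_(t | (\bot < t <= s)%O) ('X - 1) ^+ rho t.
Proof.
rewrite mulr_sumr; apply: eq_bigr => t /andP[/rank_gt0 t0 _].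
by rewrite -exprS prednK.
Qed.

(* Dehn-Sommerville equations *)
Lemma revp_hpoly (s : P) : (\bot < s)%O -> revp (rho s).-1 (hpoly s) = hpoly s.
Proof.
move=> s0; rewrite revpE /hpoly raddf_sum.
transitivity (\sum_(t | (\bot < t <= s)%O) \sum_(u | (t <= u <= s)%O)
    ((-1) ^+ (rho t).-1 * ('X - 1) ^+ (rho u).-1 : {poly int})).
  apply: eq_bigr => t /andP[t0 ts]; have rt := rank_gt0 t0; have rts := rank_le ts.
  rewrite /= homog_XsubC; last by lia.
  have -> : ((rho s).-1 - (rho t).-1 = rho s - rho t)%N by lia.
  (* The power of X = (X - 1) + 1 is expanded over [t, s]; after exchanging sums, the signs over t
     <= u add up to 1. *)
  rewrite -{2}['X](subrK 1) -interval_sum // mulr_sumr.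
  apply: eq_bigr => u /andP[tu us]; have rtu := rank_le tu.
  rewrite expr1n mulr1 -[1 - 'X]opprB (exprNn ('X - 1)) -mulrA -exprD; congr (_ * _ ^+ _); lia.
rewrite (exchange_big_dep (fun u => (\bot < u <= s)%O)) /=; last first.
  by move=> t u /andP[t0 _] /andP[tu ->]; rewrite (lt_le_trans t0 tu).
apply: eq_bigr => u /andP[u0 us].
rewrite -mulr_suml (eq_bigl (fun t => (\bot < t <= u)%O)).
  by rewrite sum_sign_below // mul1r.
move=> t; rewrite us andbT -andbA; case tu: (t <= u)%O; last by rewrite !andbF.
by rewrite (le_trans tu us).
Qed.

Lemma revp_gpoly (s : P) : (\bot < s)%O ->
  revp (rho s) (gpoly s) = gpoly s + ('X - 1) * hpoly s.
Proof.
move=> s0; rewrite -{1}(prednK (rank_gt0 s0)).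
exact/revp_antisym/revp_hpoly.
Qed.

Lemma size_gpoly (s : P) : (size (gpoly s) <= ((rho s).-1)./2.+1)%N.
Proof. exact: size_take_poly. Qed.

Lemma size_klpoly (p : P) : (size (klpoly p) <= ((rho p).-1)./2.+1)%N.
Proof.
rewrite /klpoly; case: ifP => _; first by rewrite size_poly1.
apply: (leq_trans (size_sum _ _ _)); apply/bigmax_leqP => s /andP[s0 sp].
have := rank_le sp; rewrite -signr_odd; case: odd.
  by rewrite mulN1r size_polyN => ?; apply: leq_trans (size_gpoly s) _; lia.
by rewrite mul1r => ?; apply: leq_trans (size_gpoly s) _; lia.
Qed.

(** * Identification of K with the toric g-polynomial *)

(** For fixed t, the sum over s in [t, p] is a binomial expansion of (X - 1)^(rho p - rho t); the
    remaining signs add up to 1. *)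
Lemma sum_sign_hpoly (p : P) : (\bot < p)%O ->
  \sum_(s | (\bot < s <= p)%O)
    (-1) ^+ (rho s).-1 * ('X^(rho p - rho s) * (('X - 1) * hpoly s))
  = ('X - 1) ^+ rho p.
Proof.
move=> p0.
transitivity (\sum_(s | (\bot < s <= p)%O) \sum_(t | (\bot < t <= s)%O)
   ((-1) ^+ (rho s).-1 * 'X^(rho p - rho s) * ('X - 1) ^+ rho t : {poly int})).
  by apply: eq_bigr => s _; rewrite mul_hpoly mulrA mulr_sumr.
rewrite (exchange_big_dep (fun t => (\bot < t <= p)%O)) /=; last first.
  by move=> s t /andP[_ sp] /andP[-> ts]; rewrite (le_trans ts sp).
rewrite -[RHS]mul1r -[X in X * _](sum_sign_below _ p0) mulr_suml.
apply: eq_bigr => t /andP[t0 tp].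
rewrite (eq_bigl (fun s => (t <= s <= p)%O)); last first.
  move=> s; rewrite t0 /= andbC; case ts: (t <= s)%O => //=.
  by rewrite (lt_le_trans t0 ts).
have rt := rank_gt0 t0.
transitivity (\sum_(s | (t <= s <= p)%O) (-1) ^+ (rho t).-1 * ('X - 1) ^+ rho t *
   ((-1) ^+ (rho s - rho t) * 'X^(rho p - rho s)) : {poly int}).
  apply: eq_bigr => s /andP[/rank_le ts sp].
  rewrite (_ : (rho s).-1 = (rho t).-1 + (rho s - rho t))%N; last by lia.
  by rewrite exprD -!mulrA; congr (_ * _); rewrite mulrA mulrC.
rewrite -mulr_sumr interval_sum // [-1 + _]addrC -mulrA -exprD.
by rewrite subnKC ?rank_le.
Qed.

(** By [revp_gpoly] the right side splits into h-terms, which give the summand q = \bot, and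
    g-terms, which give the others after expanding X^(rho p - rho s) over [s, p]. *)
Lemma klpoly_revp (p : P) :
  \sum_(q | (q <= p)%O) klpoly q * ('X - 1) ^+ (rho p - rho q)
    = revp (rho p) (klpoly p).
Proof.
have [->|] := eqVneq p \bot%O.
  rewrite (big_pred1 \bot%O) => [|q]; last by rewrite lex0.
  rewrite /klpoly eqxx subnn mulr1 hgraded.1; apply/polyP => i.
  by rewrite coef_poly !coef1; case: i.
rewrite -lt0x => p0.
rewrite (bigD1 \bot%O) ?le0x //= {1 3}/klpoly eqxx (gt_eqF p0) mul1r hgraded.1 subn0.
rewrite -sum_sign_hpoly // revpE raddf_sum.
transitivity (\sum_(s | (\bot < s <= p)%O)
  (-1) ^+ (rho s).-1 *
    ('X^(rho p - rho s) * (('X - 1) * hpoly s + gpoly s))); last first.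
  apply: eq_bigr => s /andP[s0 sp].
  have rs := rank_gt0 s0; have rsp := rank_le sp.
  have -> : (-1) ^+ (rho s).-1 * gpoly s = gpoly s *~ (-1) ^+ (rho s).-1.
    by rewrite -mulrzl rmorph_sign.
  rewrite raddfMz /= (@homog_widen _ _ _ (rho s)) //.
    by rewrite -revpE revp_gpoly // -mulrzl rmorph_sign [_ + gpoly s]addrC.
  by apply: leq_trans (size_gpoly s) _; lia.
under [RHS]eq_bigr => s _ do rewrite !mulrDr.
rewrite big_split /=; congr (_ + _).
transitivity (\sum_(q | (\bot < q <= p)%O) \sum_(s | (\bot < s <= q)%O)
   ((-1) ^+ (rho s).-1 * gpoly s) * ('X - 1) ^+ (rho p - rho q)).
  apply: eq_big => [q|q /andP[_ q0]]; first by rewrite lt0x andbC.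
  by rewrite /klpoly (negPf q0) mulr_suml.
rewrite (exchange_big_dep (fun s => (\bot < s <= p)%O)) /=; last first.
  by move=> q s /andP[_ qp] /andP[-> sq]; rewrite (le_trans sq qp).
apply: eq_bigr => s /andP[s0 sp].
rewrite -mulr_sumr -mulrA [gpoly s * _]mulrC; congr (_ * (_ * _)).
rewrite -{2}['X](subrK 1) [_ - _ + 1]addrC -interval_sum //.
apply: eq_big => [q|q _]; last by rewrite expr1n mul1r.
rewrite s0 /= andbC; case sq: (s <= q)%O => //=.
by rewrite (lt_le_trans s0 sq).
Qed.

(** By induction (1 - X) f = K_p - revp K_p. The degree bound keeps the reversal above the
    truncation degree, so only K_p survives. *)
Lemma toric_g_klpoly (p : P) : toric_g rho p = klpoly p.
Proof.
have [m] := ubnP (rho p); elim: m p => // m IH p; rewrite ltnS => pm.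
rewrite toric_gE; case: ifP => p0; first by rewrite /klpoly p0.
have rp : (0 < rho p)%N by apply: rank_gt0; rewrite lt0x p0.
have e : ('X - 1) * toric_f rho p = revp (rho p) (klpoly p) - klpoly p.
  rewrite -klpoly_revp (bigD1 p) //= subnn mulr1 addrAC subrr add0r.
  rewrite /toric_f p0 mulr_sumr; apply: eq_big => [q|q qp]; first by rewrite lt_neqAle andbC.
  have rq := rank_lt hgraded qp.
  rewrite IH; last by lia.
  rewrite mulrCA -exprS; congr (_ * _ ^+ _); lia.
rewrite toric_truncE -opprB mulNr e opprB; apply/polyP => i.
have sk := size_klpoly p.
rewrite coef_take_poly coefB coef_poly; case: ifP => im.
  rewrite [X in _ - X](_ : _ = 0) ?subr0 //; case: ifP => // _.
  apply: nth_default; apply: leq_trans sk _; lia.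
by rewrite nth_default // (leq_trans sk) // leqNgt im.
Qed.

Lemma toric_f_lowerE : toric_f_lower rho = revp (rho \top%O) (klpoly \top%O).
Proof.
rewrite -klpoly_revp /toric_f_lower (longest_chain_rank hgraded).
by apply: eq_big => [q|q _]; rewrite ?lex1 ?toric_g_klpoly.
Qed.

(** * Toric polynomials of the dual poset *)

(** The dual interval below [q] is Boolean, so inductively (X - 1) f = X^m - 1 with m the dual rank,
    whose truncation is 1. *)
Lemma toric_g_dual (q : P^d) : (\bot < (q : P))%O ->
  toric_g (dual_rank rho) q = 1.
Proof.
have [m] := ubnP (dual_rank rho q); elim: m q => // m IH q; rewrite ltnS => qm q0.
rewrite toric_gE; case: ifP => // qb.
have e : ('X - 1) * toric_f (dual_rank rho) q = 'X^(dual_rank rho q) - 1.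
  rewrite -{2}['X](subrK 1) /dual_rank -interval_sum ?lex1 //.
  rewrite (bigD1 (q : P)) /=; last by rewrite lexx lex1.
  rewrite subnn expr0 expr1n mulr1 addrAC subrr add0r.
  rewrite /toric_f qb mulr_sumr; apply: eq_big => [s|s].
    by rewrite ltEdual lex1 andbT lt_neqAle eq_sym andbC.
  rewrite ltEdual => qs; have rqs := rank_lt hgraded qs; have rs := rank_le (lex1 (s : P)).
  rewrite IH ?(lt_trans q0 qs) //; last first.
    by apply: leq_trans qm; rewrite /dual_rank; lia.
  rewrite mul1r -exprS expr1n mulr1 /dual_rank; congr (_ ^+ _); lia.
have rq : (0 < dual_rank rho q)%N.
  rewrite subn_gt0; apply: (rank_lt hgraded).
  by rewrite lt_neqAle lex1 andbT -[\top%O]botEdual qb.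
rewrite toric_truncE -opprB mulNr e opprB; apply/polyP => i.
rewrite coef_take_poly coefB coefXn coef1; case: ifP => im.
  by rewrite [i == dual_rank _ _]ltn_eqF ?subr0 //; lia.
by case: i im.
Qed.

Lemma toric_f_dual : (\bot < \top :> P)%O ->
  toric_f (dual_rank rho) \top%O = hpoly \top%O.
Proof.
move=> nt; rewrite /toric_f ifN; last first.
  by have := nt; rewrite lt0x eq_sym => h; exact: h.
apply: eq_big => [t|t]; first by rewrite ltEdual topEdual lex1 andbT.
rewrite ltEdual topEdual => t0; rewrite toric_g_dual // mul1r.
congr (_ ^+ _); rewrite /dual_rank hgraded.1.
have := rank_le (lex1 (t : P)); have := rank_gt0 t0; lia.
Qed.

(** The Dehn-Sommerville symmetry absorbs the reversal in [toric_h]. *)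
Lemma toric_h_dual : (\bot < \top :> P)%O ->
  toric_h (dual_rank rho) = hpoly \top%O.
Proof.
move=> nt; rewrite -[RHS]revp_hpoly // -toric_f_dual //.
by rewrite /toric_h /revp /dual_rank hgraded.1 subn0.
Qed.

(** * Expansion of K_\top in the coefficients of g_\top *)

(** As (X + w) - (1 + w) = X - 1, homogenizing (X - 1)^(rho t) only adds the factor (1 + w)^(N - rho
    t), the sum of w^(N - rho s) over s >= t. *)
Lemma sum_map_hpoly (R : comNzRingType) (w : R) :
  \sum_(s | (\bot < s)%O) (w ^+ (rho \top%O - rho s))%:P *
     map_poly intr (('X - 1) * hpoly s)
  = homog (rho \top%O) ('X + w%:P) (1 + w)%:P (('X - 1) * hpoly \top%O).
Proof.
pose F (t : P) : {poly R} := ('X - 1) ^+ rho t.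
have mapX s : map_poly intr (('X - 1) * hpoly s)
    = \sum_(t | (\bot < t <= s)%O) F t.
  rewrite mul_hpoly rmorph_sum /=.
  by apply: eq_bigr => t _; rewrite rmorphXn rmorphB rmorph1 /= map_polyX.
rewrite mul_hpoly raddf_sum /=.
under eq_bigr => s _ do rewrite mapX mulr_sumr.
rewrite (exchange_big_dep (fun t => (\bot < t <= \top)%O)) /=; last first.
  by move=> s t s0 /andP[-> _]; exact: lex1.
apply: eq_bigr => t /andP[t0 _].
rewrite homog_XsubC ?rank_le ?lex1 //.
have -> : 'X + w%:P - (1 + w)%:P = 'X - 1.
  by rewrite rmorphD /= opprD addrACA subrr addr0.
rewrite -/(F t) -rmorphXn -interval_sum ?lex1 // rmorph_sum mulr_sumr.
apply: eq_big => [s|s _]; last by rewrite expr1n mul1r mulrC.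
rewrite lex1 andbT t0 /=; case ts: (t <= s)%O; last by rewrite andbF.
by rewrite (lt_le_trans t0 ts).
Qed.

(** Here w is the inner variable. Cutting at w-degree N - 2k - 1 keeps exactly the s with rho s >
    2k, those whose truncation g_s retains degree k. *)
Lemma coef_klpoly_top (k : nat) : (k.*2 < rho \top%O)%N ->
  (klpoly \top%O)`_k = (-1) ^+ rho \top%O *
    altsum (rho \top%O - k.*2.+1)
     (homog (rho \top%O) ('X + 'X%:P) (1 + 'X)%:P (('X - 1) * hpoly \top%O))`_k.
Proof.
set N := rho \top%O => kN; rewrite -sum_map_hpoly coef_sum raddf_sum mulr_sumr.
have nt : (\top != \bot :> P)%O.
  by apply/eqP => e; move: kN; rewrite /N e hgraded.1.
rewrite /klpoly (negPf nt) coef_sum; apply: eq_big => [s|s /andP[s0 _]].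
  by rewrite lex1 andbT.
have rs := rank_gt0 s0; have rsN := rank_le (lex1 s).
have intrC (c : int) : c%:~R = c%:P :> {poly int}.
  by rewrite -[in RHS](intz c) rmorph_int.
rewrite coefCM coef_map /= intrC altsum_Xn.
have -> : (-1) ^+ (rho s).-1 = ((-1) ^+ (rho s).-1)%:P :> {poly int}.
  by rewrite rmorph_sign.
rewrite coefCM coef_take_poly -[1 - 'X]opprB mulNr coefN.
have -> : (k < ((rho s).-1)./2.+1)%N = (N - rho s <= N - k.*2.+1)%N.
  by rewrite ltnS; rewrite /N in kN rsN *; apply/idP/idP; lia.
case: ifP => _; last by rewrite !mulr0.
rewrite mulrN -mulNr mulrA; apply: (congr1 (fun z => z * _)).
rewrite -mulN1r -exprS -exprD prednK // -signr_odd -[RHS]signr_odd.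
by rewrite oddD oddB // addKb.
Qed.

Lemma homog_hpoly_top (R : comNzRingType) (a b : R) (N := rho \top%O) :
  (\bot < \top :> P)%O ->
  homog N a b (('X - 1) * hpoly \top%O) =
  \sum_(i < N.+1) (b ^+ i * a ^+ (N - i) - a ^+ i * b ^+ (N - i)) *~ (gpoly \top%O)`_i.
Proof.
move=> nt; have -> : ('X - 1) * hpoly \top%O = revp N (gpoly \top%O) - gpoly \top%O.
  by rewrite revp_gpoly // addrAC subrr add0r.
rewrite raddfB /= homog_revp /homog -sumrB; apply: eq_bigr => i _.
by rewrite mulrzBl.
Qed.

Lemma klpoly_top_ge0 (k : nat) : (\bot < \top :> P)%O ->
  (forall i, 0 <= (gpoly \top%O)`_i) -> 0 <= (klpoly \top%O)`_k.
Proof.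
move=> nt g0; case: (ltnP k.*2 (rho \top%O)) => kN; last first.
  rewrite nth_default //; apply: leq_trans (size_klpoly _) _.
  by have := rank_gt0 nt; lia.
rewrite coef_klpoly_top // homog_hpoly_top //.
set N := rho \top%O in kN *; set M := (N - k.*2.+1)%N.
have sgn : (-1) ^+ N * (-1) ^+ M = -1 :> int.
  rewrite -exprD -signr_odd (_ : odd _ = true) //.
  by rewrite /M; lia.
rewrite coef_sum raddf_sum mulr_sumr; apply: sumr_ge0 => i _.
have [gi|gi] := leqP (size (gpoly (\top%O : P))) i.
  by rewrite (nth_default 0 gi) mulr0z coef0 raddf0 mulr0.
have iN : (i.*2 < N)%N.
  by have := leq_trans gi (size_gpoly _); have := rank_gt0 nt; rewrite -/N; lia.
rewrite coefMrz raddfMz /= mulrzAr -mulrzr; apply: mulr_ge0; last by rewrite ler0z.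
have termE a b : (('X + 'X%:P) ^+ b * (1 + 'X)%:P ^+ a : {poly {poly int}})`_k
    = ('X^(b - k) *+ 'C(b, k)) * (1 + 'X) ^+ a.
  by rewrite -rmorphXn coefMC coef_XaddC_exp.
rewrite coefB [_ ^+ i * _ ^+ (N - i)]mulrC !termE raddfB /=.
have altE a b : (a.+1 + b = N)%N ->
    altsum M (('X^(b - k) *+ 'C(b, k)) * (1 + 'X) ^+ a.+1)
    = (-1) ^+ M * ('C(b, k) * 'C(a, k))%:R.
  by move=> e; rewrite /M -e altsum_bin // e.
have -> : (N - i = (N - i).-1.+1)%N by lia.
rewrite [X in _ - X]altE; last by lia.
(* For i = 0 the first product has no factor 1 + w to cancel, but its w-degree N - k exceeds M, so
   it contributes 0. *)
case: (posnP i) => [->|i0].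
  rewrite !expr0 mulr1 -mulr_natr -polyC_natr altsum_Xn ifN; last by rewrite /M; lia.
  by rewrite sub0r mulrN mulrA sgn mulN1r opprK ler0n.
rewrite -[X in (1 + 'X) ^+ X](prednK i0) altE; last by lia.
rewrite -mulrBr mulrA sgn mulN1r opprB subr_ge0 ler_nat.
have := @bin_mul_le i.-1 (N - i).-1 k; rewrite (prednK i0); apply; lia.
Qed.

End DualSimplicial.

(** * Nonnegativity of the coefficients of f *)

Unset Implicit Arguments.
Set Strict Implicit.

Theorem corollary6p10 (d : Order.disp_t) (P : finTBPOrderType d)
    (rho : P -> nat) (n : nat)
    (hgraded : rank_function rho) (hrank : rho \top%O = n.+1)
    (heulerian : eulerian rho) (hdual : dual_simplicial P)
    (hh : forall i : nat, (i < n./2)%N ->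
       (toric_h (dual_rank rho))`_i <= (toric_h (dual_rank rho))`_i.+1) :
  forall i : nat, 0 <= (toric_f_lower rho)`_i.
Proof.
have nt : (\bot < \top :> P)%O.
  by rewrite lt0x; apply/eqP => e; move: hrank; rewrite e hgraded.1.
move=> i; rewrite toric_f_lowerE // /revp coef_poly; case: ifP => // _.
apply: klpoly_top_ge0 => // j.
rewrite /gpoly hrank coef_take_poly; case: ifP => // jn.
rewrite mulrBl mul1r coefB coefXM; case: j jn => [_|j jn].
  (* The constant term is h_\top(0), a sum of signs equal to 1; the other coefficients are the
     differences of the hypothesis. *)
  rewrite subr0 -horner_coef0 /hpoly horner_sum.
  rewrite (eq_bigr (fun t => (-1) ^+ (rho t).-1)) ?sum_sign_below //.
  by move=> t _; rewrite horner_exp !hornerE ?sub0r ?add0r.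
by rewrite subr_ge0 -toric_h_dual //; exact: hh.
Qed.
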